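(* Let $s\geq2$, $n=2^{s-1}$, let $H\leq\mathbb{F}_2^s$ be a hyperplane, and let $M=[v_0,\ldots,v_{n-1}]$ be a list of $n$ nonzero vectors of $\mathbb{F}_2^s$ with $\sum_{i}v_i=0$. Suppose that exactly two of the indices $i$ satisfy $v_i\in H$ (i.e. $M$ is a zero-sum two-hole instance with respect to $H$), and that every vector occurring in $M$ occurs with even multiplicity. Then $M$ has a Hadamard pair solution, and such a solution can be constructed by reducing to an all-crossing Hall instance on a quotient space of $\mathbb{F}_2^s$, solving that quotient instance by the algorithm BSolution, and lifting the resulting matching.
   Context: A Hadamard pair solution for a list $[v_0,\ldots,v_{N-1}]$ of $N=2^{d-1}$ nonzero vectors of a $d$-dimensional $\mathbb{F}_2$-vector space $V$ is a partition of $V$ into pairs $\{x_i,y_i\}$, $0\leq i<N$, with $x_i+y_i=v_i$ for all $i$. A request $v$ is internal with respect to a hyperplane if it lies in it, crossing otherwise. An all-crossing Hall instance on $V$ is a zero-sum list of $2^{d-1}$ vectors of $V$, all lying outside one fixed hyperplane of $V$. BSolution is a known algorithm which, for every all-crossing Hall instance, explicitly constructs a Hadamard pair solution; it may be treated as a black box with this guarantee. The quotient here is $\mathbb{F}_2^s/L$ with $L=\{0,p\}$ a one-dimensional subspace of $H$; lifting means that a quotient edge $\{X,Y\}$ with $X+Y=v+L$ is replaced by the two parallel edges $\{x,x+v\}$, $\{x+p,x+p+v\}$ ($x\in X$), while a coset $\{x,x+p\}$ not covered by a lifted quotient edge is itself used as a pair. When $s=2$ there are no crossing requests and the quotient step is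 vacuous. *)

(* Defs.v *)
From HB Require Import structures.
From mathcomp Require Export all_boot all_order all_algebra.


Set Implicit Arguments.
Unset Strict Implicit.
Unset Printing Implicit Defensive.

Import GRing.Theory.
Local Open Scope ring_scope.
Local Open Scope quotient_scope.

(* The library provides V / U only as a zmodType ([Quotient.quot]); the scalar
   multiplication and the finite-dimensional structure are added here. *)
Section QuotientSpace.
Variables (F : fieldType) (V : vectType F) (U : {vspace V}).

Definition vquot : Type := Quotient.quot (pred_of_vspace U : zmodClosed V).

HB.instance Definition _ := EqQuotient.on vquot.
HB.instance Definition _ := Choice.on vquot.
HB.instance Definition _ := GRing.Zmodule.on vquot.

Definition vpi (v : V) : vquot := \pi_vquot v.

Lemma vpi_eq x y : (vpi x == vpi y) = (x - y \in U).
Proof. by rewrite /vpi piE. Qed.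

Lemma vpi_is_zmod_morphism : zmod_morphism vpi.
Proof. by move=> x y; rewrite /vpi !piE. Qed.

HB.instance Definition _ :=
  GRing.isZmodMorphism.Build V vquot vpi vpi_is_zmod_morphism.

Lemma repr_vpi X : vpi (repr X) = X. Proof. exact: reprK. Qed.

Definition vquot_scale (a : F) (X : vquot) : vquot := vpi (a *: repr X).

Lemma vquot_scale_pi a x : vquot_scale a (vpi x) = vpi (a *: x).
Proof.
apply/eqP; rewrite vpi_eq -scalerBr rpredZ //.
by rewrite -vpi_eq repr_vpi.
Qed.

Lemma vquot_scalerA a b X :
  vquot_scale a (vquot_scale b X) = vquot_scale (a * b) X.
Proof. by rewrite -[X]repr_vpi !vquot_scale_pi scalerA. Qed.

Lemma vquot_scale1r : left_id 1 vquot_scale.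
Proof. by move=> X; rewrite -[X]repr_vpi !vquot_scale_pi scale1r. Qed.

Lemma vquot_scalerDr : right_distributive vquot_scale +%R.
Proof.
move=> a X Y; rewrite -[X]repr_vpi -[Y]repr_vpi -raddfD !vquot_scale_pi.
by rewrite scalerDr raddfD.
Qed.

Lemma vquot_scalerDl X : {morph vquot_scale^~ X : a b / a + b}.
Proof.
by move=> a b; rewrite -[X]repr_vpi !vquot_scale_pi scalerDl raddfD.
Qed.

HB.instance Definition _ := GRing.Zmodule_isLmodule.Build F vquot
  vquot_scalerA vquot_scale1r vquot_scalerDr vquot_scalerDl.

Lemma vpi_is_scalable : scalable vpi.
Proof. by move=> a x; rewrite -vquot_scale_pi. Qed.

HB.instance Definition _ :=
  GRing.isScalable.Build F V vquot *:%R vpi vpi_is_scalable.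

Let f (v : V) : 'rV_(\dim U^C) :=
  \row_i coord (vbasis U^C) i (v - projv U v).

Let f_linear : linear f.
Proof.
by move=> k v w; apply/rowP=> i; rewrite !mxE linearP opprD addrACA -scalerBr
  linearP.
Qed.

Let f_vpi v : f (repr (vpi v)) = f v.
Proof.
have : repr (vpi v) - v \in U by rewrite -vpi_eq repr_vpi.
move: (repr _) => w /projv_id; rewrite linearB /= => e.
apply/rowP=> i; rewrite !mxE; congr (coord _ i _); apply/eqP.
by rewrite -subr_eq0 opprD addrACA -opprD e subrr.
Qed.

Fact vquot_vect_iso : Vector.axiom (\dim U^C) vquot.
Proof.
exists (fun X => f (repr X)).
  by move=> k X Y; rewrite -f_linear -{1}[X]repr_vpi -{1}[Y]repr_vpi
    -linearP /= f_vpi.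
exists (fun r : 'rV_(\dim U^C) => vpi (\sum_i r 0 i *: (vbasis U^C)`_i)).
  move=> X /=; rewrite -[RHS]repr_vpi; apply/eqP; rewrite vpi_eq.
  under eq_bigr do rewrite mxE.
  rewrite -(coord_vbasis (memv_projC U (repr X))) addrAC subrr add0r rpredN.
  exact: memv_proj.
move=> r; rewrite f_vpi; set w := \sum_i _.
have wU : w \in (U^C)%VS.
  by apply: rpred_sum => j _; rewrite rpredZ ?vbasis_mem ?memt_nth.
have pw0 : projv U w = 0.
  have: (projv U w \in U :&: U^C)%VS.
    by rewrite memv_cap memv_proj -[projv U w](subKr w) rpredB ?memv_projC.
  by rewrite capv_compl memv0 => /eqP.
apply/rowP=> i; rewrite mxE pw0 subr0.
by rewrite coord_sum_free ?(basis_free (vbasisP _)).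
Qed.

HB.instance Definition _ := Lmodule_hasFinDim.Build F vquot vquot_vect_iso.

End QuotientSpace.

Section Instances.
Variable V : vectType 'F_2.
Implicit Types (H : {vspace V}) (M : seq V) (P : seq (V * V)).

Definition hyperplane H : Prop := (\dim H).+1 = \dim {:V}.

(* The i-th pair of P is {x_i, y_i}; the second and third clauses say that the
   pairs are disjoint, each has two elements, and together they cover V. *)
Definition hadamard_pair_solution M P : Prop :=
  [/\ [seq e.1 + e.2 | e <- P] = M,
      uniq (unzip1 P ++ unzip2 P) &
      forall x : V, x \in unzip1 P ++ unzip2 P].

Definition all_crossing_hall H M : Prop :=
  [/\ hyperplane H, size M = (2 ^ (\dim {:V}).-1)%N,
      \sum_(v <- M) v = 0 & forall v, v \in M -> v \notin H].

End Instances.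

Definition solver : Type :=
  forall V : vectType 'F_2, {vspace V} -> seq V -> seq (V * V).

Definition solves_all_crossing_hall (B : solver) : Prop :=
  forall (V : vectType 'F_2) (H : {vspace V}) (M : seq V),
    all_crossing_hall H M -> hadamard_pair_solution M (B V H M).

Section Reduction.
Variables (s : nat) (p : 'rV['F_2]_s).
Local Notation Q := (vquot <[p]>%VS).

(* A quotient edge {X, Y} is given together with the request v to be used for
   it, X + Y = v + <[p]>. The two unordered pairs obtained do not depend on the
   representative x of X. *)
Definition lift_edge (ev : (Q * Q) * 'rV['F_2]_s) :
    seq ('rV['F_2]_s * 'rV['F_2]_s) :=
  let x := repr ev.1.1 in
  [:: (x, x + ev.2); (x + p, x + p + ev.2)].

Definition coset_pair (X : Q) : 'rV['F_2]_s * 'rV['F_2]_s :=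
  (repr X, repr X + p).

Definition cosets : seq Q :=
  undup [seq vpi <[p]>%VS x | x <- enum {: 'rV['F_2]_s}].

Definition lift_matching (E : seq ((Q * Q) * 'rV['F_2]_s)) :
    seq ('rV['F_2]_s * 'rV['F_2]_s) :=
  flatten [seq lift_edge ev | ev <- E] ++
  [seq coset_pair X | X <- cosets &
     X \notin unzip1 (unzip1 E) ++ unzip2 (unzip1 E)].

Definition quotient_hyperplane (H : {vspace 'rV['F_2]_s}) : {vspace Q} :=
  (linfun (vpi <[p]>%VS) @: H)%VS.

End Reduction.

(* M consists of the internal request p twice and of the crossing requests W,
   each twice. The quotient instance has one request for each entry of W, plus
   a completing request c, whose edge is the only one that is not lifted.
   For s = 2 no request is crossing and only cosets are used. *)
Definition by_quotient_reduction (B : solver) (s : nat)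
    (H : {vspace 'rV['F_2]_s}) (M : seq 'rV['F_2]_s)
    (P : seq ('rV['F_2]_s * 'rV['F_2]_s)) : Prop :=
  exists (p : 'rV['F_2]_s) (W : seq 'rV['F_2]_s),
    [/\ p != 0, p \in H, (forall w, w \in W -> w \notin H),
        perm_eq M ([:: p; p] ++ W ++ W) &
        if s == 2%N then perm_eq P (lift_matching (p := p) [::]) : Prop
        else exists c : vquot <[p]>%VS,
          let R := c :: [seq vpi <[p]>%VS w | w <- W] in
          let HQ := quotient_hyperplane p H in
          all_crossing_hall HQ R /\
          perm_eq P (lift_matching (zip (behead (B (vquot <[p]>%VS) HQ R)) W))].

(* Main.v *)
(* Halving the multiplicities, M is p, p, W, W with p the internal request and
   W crossing. Modulo <[p]> the images of W, together with their sum c, form an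
   all-crossing Hall instance: #|W| = 2 ^ (s - 2) - 1 is odd, so c is crossing.
   In a solution of it, the edges of W lift to pairs with sums W, W, and the two
   cosets on the discarded edge of c give the sums p, p. The resulting
   2 ^ (s - 1) pairs cover the whole space, hence are disjoint. *)
Require Import Defs.
Import GRing.Theory.
Local Open Scope ring_scope.

Set Implicit Arguments.
Unset Strict Implicit.
Unset Printing Implicit Defensive.

(** * Permutations and multiplicities in lists *)

Lemma perm_eq_map_preimage (T U : eqType) (f : T -> U) (r : seq T) (t : seq U) :
  perm_eq (map f r) t -> exists2 r', perm_eq r' r & map f r' = t.
Proof.
elim: t r => [|y t IH] r rt.
  by exists [::] => //; case: r rt => // x r /perm_size.
have /mapP[x xr yx]: y \in map f r by rewrite (perm_mem rt) mem_head.
have rx := perm_to_rem xr.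
have /IH[r' r'r fr']: perm_eq (map f (rem x r)) t.
  by rewrite -(perm_cons y) -(permPr rt) perm_sym {1}yx (perm_map f rx).
by exists (x :: r'); rewrite /= -?yx ?fr' // (permPr rx) perm_cons.
Qed.

(** Induction on the size: the head of the list must occur again in the tail, and removing both
    copies keeps every multiplicity even. *)
Lemma even_multiplicities_halve (T : eqType) (r : seq T) :
  {in r, forall x, ~~ odd (count_mem x r)} -> exists h, perm_eq r (h ++ h).
Proof.
have [n le_rn] := ubnP (size r); elim: n r le_rn => // n IH [|x r] /=.
  by exists [::].
move=> le_rn even_r.
have xr: x \in r.
  rewrite -has_pred1 has_count lt0n.
  apply: contraTneq (even_r x (mem_head _ _)).
  by rewrite eqxx => ->.
have rx := perm_to_rem xr.
have [||h rh] := IH (rem x r).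
- rewrite size_rem //; case: (r) xr le_rn => //= _ r' _.
  by rewrite !ltnS => /ltnW.
- move=> y /mem_rem yr; have := even_r y.
  rewrite inE yr orbT (permP rx) /= addnA oddD => /(_ isT).
  by case: (x == y).
exists (x :: h); rewrite /= perm_cons (permPl rx).
by rewrite perm_sym -cat1s perm_catCA /= perm_cons perm_sym.
Qed.

Lemma map_eq_zip (T U : eqType) (R : Type) (f : T -> R) (g : U -> R) r t :
  map f r = map g t -> {in zip r t, forall e, f e.1 = g e.2}.
Proof.
elim: r t => [|x r IH] [|y t] //= [fx_gy /IH{}IH] e.
by rewrite inE => /predU1P[-> //|/IH].
Qed.

(** * Lines and hyperplanes over the two-element field *)

Section CharTwo.
Variable V : vectType 'F_2.
Implicit Types (x y : V) (H : {vspace V}).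

Lemma F2_addvv x : x + x = 0.
Proof. by rewrite -mulr2n -scaler_nat pchar_Zp ?scale0r. Qed.

Lemma F2_addvK x y : x + (x + y) = y.
Proof. by rewrite addrA F2_addvv add0r. Qed.

Lemma F2_vlineP x y : reflect (y = 0 \/ y = x) (y \in <[x]>%VS).
Proof.
apply: (iffP (vlineP y x)) => [[k ->]|[] ->]; last 2 first.
- by exists 0; rewrite scale0r.
- by exists 1; rewrite scale1r.
case: k => [[|[|//]]] k; [left|right].
  by rewrite (_ : Ordinal k = 0) ?scale0r //; apply: val_inj.
by rewrite (_ : Ordinal k = 1) ?scale1r //; apply: val_inj.
Qed.

(** Since [x] spans a complement of [H], [y] is [h] or [h + x] with [h] in [H]; the first is
    excluded because [y] is outside [H], and the second gives [x + y = h]. *)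
Lemma F2_hyperplaneD H x y :
  hyperplane H -> x \notin H -> y \notin H -> x + y \in H.
Proof.
move=> hH xH yH.
have /eqP full: (H + <[x]> == fullv)%VS.
  rewrite eqEdim subvf -hH dimv_disjoint_sum.
    rewrite dim_vline -addn1 leq_add2l lt0b.
    by apply: contraNneq xH => ->; rewrite mem0v.
  apply/eqP; rewrite -subv0; apply/subvP => v; rewrite memv_cap => /andP[vH].
  by case/F2_vlineP=> v_eq; rewrite v_eq ?mem0v //; rewrite -v_eq vH in xH.
have /memv_addP[h hh [w /F2_vlineP w_eq y_eq]]: y \in (H + <[x]>)%VS.
  by rewrite full memvf.
case: w_eq y_eq yH => -> ->; first by rewrite addr0 hh.
by rewrite addrCA F2_addvv addr0.
Qed.

Lemma F2_hyperplane_sum H (W : seq V) : hyperplane H ->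
  {in W, forall w, w \notin H} -> (\sum_(w <- W) w \in H) = ~~ odd (size W).
Proof.
move=> hH; elim: W => [|w W IH] cross; first by rewrite big_nil mem0v.
rewrite big_cons /= negbK.
have wH: w \notin H by rewrite cross ?mem_head.
have {}IH := IH (fun v vW => cross v (mem_behead (s := w :: W) vW)).
case oddW: (odd _) IH => /= IH; first by rewrite F2_hyperplaneD // IH.
by rewrite rpredDr ?IH //; apply: negbTE.
Qed.

End CharTwo.

(** * The quotient by the line spanned by [p] *)

Section Quotient.
Variables (s : nat) (p : 'rV['F_2]_s).
Hypothesis p_neq0 : p != 0.
Local Notation Q := (vquot <[p]>%VS).
Local Notation pi := (vpi <[p]>%VS).

Lemma dim_quotient_line : \dim {:Q} = s.-1.
Proof.
rewrite dimvf -[LHS]/(\dim <[p]>^C) dimv_compl dimvf dim_matrix mul1r.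
by rewrite dim_vline p_neq0 subn1.
Qed.

Lemma vpi_lineP x y : reflect (y = x \/ y = x + p) (pi y == pi x).
Proof.
rewrite vpi_eq; apply: (iffP (F2_vlineP p (y - x))).
  case=> [/eqP|yx]; first by rewrite subr_eq0 => /eqP; left.
  by right; rewrite -yx addrC subrK.
by case=> ->; [left; rewrite subrr|right; rewrite addrC addKr].
Qed.

Lemma repr_vpiP x : x = repr (pi x) \/ x = repr (pi x) + p.
Proof. by apply/vpi_lineP; rewrite repr_vpi. Qed.

Lemma mem_cosets X : X \in cosets p.
Proof. by rewrite mem_undup -[X]repr_vpi map_f ?mem_enum. Qed.

(** The cosets are in bijection, through coordinates, with row vectors of length [s.-1] over the
    two-element field. *)
Lemma size_cosets : size (cosets p) = (2 ^ s.-1)%N.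
Proof.
pose f : 'rV_(dim Q) -> Q := @VectorInternalTheory.r2v _ Q.
have f_inj: injective f := can_inj VectorInternalTheory.r2vK.
have/perm_size ->: perm_eq (cosets p) (map f (enum {: 'rV_(dim Q)})).
  apply: uniq_perm; rewrite ?undup_uniq ?(map_inj_uniq f_inj) ?enum_uniq //.
  move=> X; rewrite mem_cosets -[X]VectorInternalTheory.v2rK.
  by rewrite map_f ?mem_enum.
by rewrite size_map -cardE card_mx card_Fp // -dimvf dim_quotient_line mul1n.
Qed.

Lemma mem_quotient_hyperplane (H : {vspace 'rV['F_2]_s}) x :
  p \in H -> (pi x \in quotient_hyperplane p H) = (x \in H).
Proof.
move=> pH; apply/memv_imgP/idP => [[h hH]|xH]; last first.
  by exists x; rewrite ?lfunE.
rewrite lfunE /= => /eqP/vpi_lineP[] -> //.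
by rewrite rpredD.
Qed.

(** The kernel of the projection is the line of [p], which lies in [H]; hence the dimensions of [H]
    and of the whole space both drop by one. *)
Lemma hyperplane_quotient (H : {vspace 'rV['F_2]_s}) :
  p \in H -> hyperplane H -> hyperplane (quotient_hyperplane p H).
Proof.
move=> pH hH; rewrite /hyperplane dim_quotient_line.
have dimH : \dim H = s.-1.
  by rewrite -[LHS]/((\dim H).+1.-1) hH dimvf dim_matrix mul1r.
have kerE: lker (linfun pi) = <[p]>%VS.
  by apply/vspaceP => x; rewrite memv_ker lfunE /= -(raddf0 pi) vpi_eq subr0.
have := limg_ker_dim (linfun pi) H; rewrite kerE.
have/capv_idPr -> : (<[p]> <= H)%VS by rewrite -memvE.
rewrite dim_vline p_neq0 add1n => ->; exact: dimH.
Qed.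

(** * Lifting a partial matching of the quotient *)

Section Lift.
Variable E : seq ((Q * Q) * 'rV['F_2]_s).
Let ends := unzip1 (unzip1 E) ++ unzip2 (unzip1 E).
Hypothesis uniq_ends : uniq ends.
Hypothesis E_sum : {in E, forall e, e.1.1 + e.1.2 = pi e.2}.

Lemma size_uncovered_cosets :
  size [seq X <- cosets p | X \notin ends] = (2 ^ s.-1 - (size E).*2)%N.
Proof.
have size_ends : size ends = (size E).*2 by rewrite size_cat !size_map addnn.
have/perm_size covered: perm_eq [seq X <- cosets p | X \in ends] ends.
  apply: uniq_perm; rewrite ?filter_uniq ?undup_uniq // => X.
  by rewrite mem_filter mem_cosets andbT.
rewrite -size_cosets -size_ends -covered.
have := count_predC (mem ends) (cosets p); rewrite -!size_filter => <-.
by rewrite addKn.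
Qed.

(** Both parallel edges over a quotient edge have its request as sum, and an uncovered coset
    [{x, x + p}] has sum [p]. *)
Lemma lift_matching_sums :
  perm_eq [seq e.1 + e.2 | e <- lift_matching E]
    (unzip2 E ++ unzip2 E ++ nseq (2 ^ s.-1 - (size E).*2)%N p).
Proof.
rewrite /lift_matching map_cat catA perm_cat //; last first.
  rewrite -size_uncovered_cosets -map_comp.
  by elim: [seq _ <- _ | _] => //= X r; rewrite F2_addvK perm_cons.
elim: (E) => //= e r IH; rewrite !F2_addvK perm_cons.
by rewrite perm_sym -cat1s perm_catCA /= perm_cons perm_sym.
Qed.

Lemma mem_lift_matching x :
  x \in unzip1 (lift_matching E) ++ unzip2 (lift_matching E).
Proof.
have pairP (e : 'rV_s * 'rV_s) : e \in lift_matching E -> x = e.1 \/ x = e.2 ->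
    x \in unzip1 (lift_matching E) ++ unzip2 (lift_matching E).
  by move=> eP [] ->; rewrite mem_cat map_f ?orbT.
have [|xE] := boolP (pi x \in ends); last first.
  apply: (pairP (coset_pair (pi x))); last exact: repr_vpiP.
  by rewrite mem_cat map_f ?orbT // mem_filter xE mem_cosets.
have edgeP e e' : e \in E -> e' \in lift_edge e -> e' \in lift_matching E.
  move=> eE e'e; rewrite mem_cat; apply/orP; left.
  by apply/flatten_mapP; exists e.
rewrite mem_cat => /orP[] /mapP[_ /mapP[e eE ->] xe].
  (* Over the first end of an edge, the two vectors are the first components of its two lifts. *)
  have := repr_vpiP x; rewrite xe => -[xE|xE].
    by apply: (pairP _ (edgeP _ _ eE (mem_head _ _))); left.
  by apply: (pairP _ (edgeP _ _ eE (mem_last _ _))); left.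
(* Over the second end, [E_sum] shows that translating a representative of the first end by the
   request lands in the coset of [x], so [x] is a second component. *)
have /eqP/vpi_lineP xE: pi x = pi (repr e.1.1 + e.2).
  by rewrite raddfD /= repr_vpi -(E_sum eE) F2_addvK.
case: xE => xE.
  by apply: (pairP _ (edgeP _ _ eE (mem_head _ _))); right.
by apply: (pairP _ (edgeP _ _ eE (mem_last _ _))); right; rewrite addrAC.
Qed.

Lemma size_lift_matching : size (lift_matching E) = (2 ^ s.-1)%N.
Proof.
rewrite size_cat size_map size_uncovered_cosets.
have ->: size (flatten [seq lift_edge e | e <- E]) = (size E).*2.
  by elim: (E) => //= e r ->.
rewrite subnKC //.
have: (size ends <= size (cosets p))%N.
  by apply: uniq_leq_size => // X _; rewrite mem_cosets.
by rewrite size_cosets size_cat !size_map addnn.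
Qed.

(** Pigeonhole: the endpoints form a list of length [2 ^ s] that covers all [2 ^ s] vectors, so none
    is repeated. *)
Lemma uniq_lift_matching : (0 < s)%N ->
  uniq (unzip1 (lift_matching E) ++ unzip2 (lift_matching E)).
Proof.
move=> s_gt0; apply: (leq_size_uniq (enum_uniq {: 'rV['F_2]_s})).
  by move=> x _; apply: mem_lift_matching.
rewrite -cardE card_mx card_Fp // mul1n size_cat !size_map size_lift_matching.
by rewrite addnn -mul2n -expnS prednK.
Qed.

End Lift.
End Quotient.

(** * Splitting the requests and assembling the solution *)

Lemma double_decomposition (V : vectType 'F_2) (H : {vspace V}) (M : seq V) :
  count (fun v => v \in H) M = 2%N ->
  {in M, forall v, ~~ odd (count_mem v M)} ->
  exists p W, [/\ p \in H, {in W, forall w, w \notin H} &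
    perm_eq M ([:: p; p] ++ W ++ W)].
Proof.
move=> two /even_multiplicities_halve[D MD].
(* The two internal requests of [M] are shared equally by the two copies of [D], so they are one
   vector [p] taken twice. *)
have: size [seq v <- D | v \in H] = 1%N.
  apply: double_inj; rewrite size_filter -addnn -count_cat.
  by rewrite -(permP MD) two.
case DH: [seq _ <- D | _] => [|p []] // _.
exists p, [seq v <- D | v \notin H]; split.
- have: p \in [seq v <- D | v \in H] by rewrite DH mem_head.
  by rewrite mem_filter => /andP[].
- by move=> w; rewrite mem_filter => /andP[].
have Dp: perm_eq D (p :: [seq v <- D | v \notin H]).
  rewrite -[X in perm_eq _ X]cat1s -DH perm_sym.
  by rewrite (perm_filterC (fun v => v \in H)).
rewrite (permPl MD) (permPl (perm_cat Dp Dp)) /= perm_cons.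
by rewrite -cat1s perm_catCA.
Qed.

Theorem theorem25 (BSolution : solver)
    (hB : solves_all_crossing_hall BSolution)
    (s : nat) (hs : (2 <= s)%N)
    (H : {vspace 'rV['F_2]_s}) (hH : hyperplane H)
    (M : seq 'rV['F_2]_s)
    (hsize : size M = (2 ^ s.-1)%N)
    (hnz : forall v, v \in M -> v != 0)
    (hsum : \sum_(v <- M) v = 0)
    (htwo : count (fun v => v \in H) M = 2%N)
    (heven : forall v, v \in M -> ~~ odd (count_mem v M)) :
  exists P : seq ('rV['F_2]_s * 'rV['F_2]_s),
    hadamard_pair_solution M P /\ by_quotient_reduction BSolution H M P.
Proof.
have [p [W [pH WH MpW]]] := double_decomposition htwo heven.
have p0: p != 0 by rewrite hnz // (perm_mem MpW) mem_head.
have sizeW: (size W).+1.*2 = (2 ^ s.-1)%N.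
  by rewrite -hsize (perm_size MpW) /= size_cat addnn.
(* It is enough to find disjoint quotient edges whose requests are exactly [W]: they leave two
   cosets uncovered, which serve the requests [p, p]. *)
suff [E [uE sE WE redE]] : exists E : seq ((vquot <[p]> * vquot <[p]>) * 'rV_s),
    [/\ uniq (unzip1 (unzip1 E) ++ unzip2 (unzip1 E)),
      {in E, forall e, e.1.1 + e.1.2 = vpi <[p]>%VS e.2}, unzip2 E = W &
      forall P, perm_eq P (lift_matching E) ->
        by_quotient_reduction BSolution H M P].
  (* The sums of a solution must follow the order of [M], so the lifted pairs are rearranged;
     [by_quotient_reduction] allows this. *)
  have /perm_eq_map_preimage[P PE sumP] :
      perm_eq [seq e.1 + e.2 | e <- lift_matching E] M.
    rewrite (permPl (lift_matching_sums p0 uE)) WE perm_sym (permPl MpW).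
    have ->: (2 ^ s.-1 - (size E).*2)%N = 2%N.
      by rewrite -sizeW -WE size_map doubleS -addn2 addKn.
    by rewrite [X in perm_eq _ X]catA perm_catC.
  exists P; split; last exact: redE.
  have PE12 : perm_eq (unzip1 P ++ unzip2 P)
                (unzip1 (lift_matching E) ++ unzip2 (lift_matching E)).
    by rewrite perm_cat // perm_map.
  split=> // [|x]; last by rewrite (perm_mem PE12) mem_lift_matching.
  by rewrite (perm_uniq PE12) uniq_lift_matching // ltnW.
have [s2|s2] := eqVneq s 2%N.
  have W0: W = [::].
    (* For [s = 2] the size equation reads [2 * (size W + 1) = 2], and the empty matching is
       lifted. *)
    apply/size0nil/succn_inj/double_inj; rewrite sizeW.
    by have ->: s.-1 = 1%N by rewrite s2.
  exists [::]; rewrite W0; split=> // P PE; exists p, W.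
  by split=> //; rewrite (introT eqP s2).
pose R := vpi <[p]>%VS (\sum_(w <- W) w) :: [seq vpi <[p]>%VS w | w <- W].
pose HQ := quotient_hyperplane p H.
have sizeW1: (size W).+1 = (2 ^ s.-2)%N.
  by apply: double_inj; rewrite sizeW -mul2n -expnS prednK // -subn1 subn_gt0.
(* Here [s > 2], so [2 ^ s.-2] is even; this parity makes the completing request crossing. *)
have oddW: odd (size W).
  have := congr1 odd sizeW1; rewrite oddX -subn2 subn_eq0 leqNgt ltn_neqAle.
  by rewrite eq_sym s2 hs => /negbFE.
have hR: all_crossing_hall HQ R.
  split; first exact: hyperplane_quotient.
  - by rewrite /= size_map dim_quotient_line.
  - by rewrite big_cons big_map raddf_sum F2_addvv.
  - move=> X; rewrite inE => /orP[/eqP->|/mapP[w wW ->]].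
      by rewrite mem_quotient_hyperplane // F2_hyperplane_sum // oddW.
    by rewrite mem_quotient_hyperplane // WH.
have [sumB uniqB _] := hB _ _ _ hR.
(* The sums follow the order of [R], so the head [e0] is the edge of the completing request and the
   tail [B] matches [W] entry by entry. *)
case BE: (BSolution _ HQ R) sumB uniqB => [|e0 B] //= [_ sumB] uniqB.
have sizeB: size B = size W.
  by rewrite -[LHS](size_map (fun e => e.1 + e.2)) sumB size_map.
exists (zip B W); rewrite unzip1_zip ?sizeB // unzip2_zip ?sizeB //; split=> //.
(* The ends of [B] form a subsequence of the ends of the full quotient solution. *)
- move: uniqB => /andP[_]; apply: subseq_uniq.
  by rewrite cat_subseq ?subseq_cons.
- exact: map_eq_zip sumB.
move=> P PE; exists p, W; split=> //; rewrite (negPf s2).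
by exists (vpi <[p]>%VS (\sum_(w <- W) w)); split=> //; rewrite -/R -/HQ BE.
Qed.
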